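(* Let $\mathcal{A}$ be a central and essential arrangement in $\mathbb{Q}^l$ as in the context, let $\sigma$ be a term ordering and $p$ a prime. Then the following are equivalent: (1) $p$ is good and $(\sigma,l)$-lucky for $\mathcal{A}$; (2) $\mathcal{A}$ and $\mathcal{A}_p$ are combinatorially equivalent.
   Context: $\mathcal{A}=\{H_1,\dots,H_n\}$ is an arrangement of $n$ distinct, linearly ordered linear hyperplanes in $\mathbb{Q}^l$ with $\bigcap_iH_i=\{0\}$. $H_i=\{\alpha_i=0\}$ with $\alpha_i\in\mathbb{Z}[x_1,\dots,x_l]$ a nonzero linear form whose coefficients are not all divisible by any prime; $Q(\mathcal{A})=\prod\alpha_i$. $\pi_p$ denotes reduction mod $p$ and $(\alpha_i)_p=\pi_p(\alpha_i)$; $p$ is good if $\pi_p(Q(\mathcal{A}))$ is reduced (no $(\alpha_i)_p$ is a scalar multiple of $(\alpha_j)_p$ for $i<j$). $\mathcal{A}_p=\{(H_1)_p,\dots,(H_n)_p\}$ is the arrangement (hyperplanes counted with the indexing) in $\mathbb{F}_p^l$ with $(H_i)_p=\{(\alpha_i)_p=0\}$. Two indexed families $\{H^{(1)}_i\}_{i=1}^n$ in $K_1^l$ and $\{H^{(2)}_i\}_{i=1}^n$ in $K_2^l$ are combinatorially equivalent if $\dim(H^{(1)}_{i_1}\cap\dots\cap H^{(1)}_{i_k})=\dim(H^{(2)}_{i_1}\cap\dots\cap H^{(2)}_{i_k})$ for all $1\le i_1<\dots<i_k\le n$ (dimension of $\emptyset$ is $-1$). Gröbner notions: for a term ordering $\sigma$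 and nonzero $f\in\mathbb{Z}[x_1,\dots,x_l]$, $\mathrm{LT}_\sigma(f)$ is the $\sigma$-largest term of $f$, $\mathrm{LC}_\sigma(f)$ its coefficient, $\mathrm{LM}_\sigma(f)=\mathrm{LC}_\sigma(f)\mathrm{LT}_\sigma(f)$. A finite set $G$ of nonzero elements of an ideal $I\subseteq\mathbb{Z}[x_1,\dots,x_l]$ is a minimal strong $\sigma$-Gröbner basis if it generates $I$, every nonzero $f\in I$ has $\mathrm{LM}_\sigma(f)$ divisible by some $\mathrm{LM}_\sigma(g)$, $g\in G$, and no $\mathrm{LM}_\sigma(g)$ divides $\mathrm{LM}_\sigma(g')$ for distinct $g,g'\in G$; the set of leading coefficients is independent of the choice. $p$ is $\sigma$-lucky for $I$ if $p$ divides no leading coefficient of a minimal strong $\sigma$-Gröbner basis of $I$. For $1\le k\le n$, $p$ is $(\sigma,k)$-lucky for $\mathcal{A}$ if $p$ is $\sigma$-lucky for every ideal $\langle\alpha_{i_1},\dots,\alpha_{i_k}\rangle\subseteq\mathbb{Z}[x_1,\dots,x_l]$ with $i_1<\dots<i_k$ and $\operatorname{codim}(H_{i_1}\cap\dots\cap H_{i_k})=k$. *)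

(* Defs.v *)
From HB Require Import structures.
From mathcomp Require Import all_boot all_order all_algebra.
From mathcomp Require Import mpoly.
Set Implicit Arguments. Unset Strict Implicit. Unset Printing Implicit Defensive.
Import Order.TTheory GRing.Theory Num.Theory.
Local Open Scope ring_scope.

(* A linear form alpha in Z[x_1..x_l] is stored by its integer coefficient row
   vector a : 'rV[int]_l, alpha = \sum_j a_j x_j. *)

Definition lform (l : nat) (a : 'rV[int]_l) : {mpoly int[l]} :=
  \sum_(j < l) (a ord0 j)%:MP * 'X_j.

Definition redF (F : fieldType) (l : nat) (a : 'rV[int]_l) : 'rV[F]_l :=
  map_mx (fun z : int => z%:~R) a.

(* the hyperplane {alpha = 0} in F^l, as a subspace (row space) of F^l *)
Definition hyp (F : fieldType) (l : nat) (a : 'rV[int]_l) : 'M[F]_l :=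
  kermx (redF F a)^T.

Definition dimI (F : fieldType) (l n : nat) (alpha : 'I_n -> 'rV[int]_l)
  (S : {set 'I_n}) : nat :=
  \rank (\bigcap_(i in S) hyp F (alpha i))%MS.

Definition primitive_form (l : nat) (a : 'rV[int]_l) : Prop :=
  a != 0 /\ forall q : nat, prime q -> ~ (forall j, (q%:Z %| a ord0 j)%Z).

Definition central_essential_arrangement (l n : nat)
  (alpha : 'I_n -> 'rV[int]_l) : Prop :=
  [/\ forall i, primitive_form (alpha i),
      forall i j, i != j -> ~~ (hyp rat (alpha i) == hyp rat (alpha j))%MS
    &
      dimI rat alpha setT = 0%N].

Definition good_prime (l n : nat) (alpha : 'I_n -> 'rV[int]_l) (p : nat) : Prop :=
  forall i j : 'I_n, (i < j)%N ->
    ~ exists c : 'F_p, redF 'F_p (alpha i) = c *: redF 'F_p (alpha j).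

Definition comb_equiv_mod (l n : nat) (alpha : 'I_n -> 'rV[int]_l) (p : nat) : Prop :=
  forall S : {set 'I_n}, S != set0 -> dimI rat alpha S = dimI 'F_p alpha S.

Definition term_order (l : nat) (lt : rel 'X_{1..l}) : Prop :=
  [/\ irreflexive lt, transitive lt,
      (forall m1 m2, m1 != m2 -> lt m1 m2 || lt m2 m1),
      (forall m1 m2 u, lt m1 m2 -> lt (m1 + u)%MM (m2 + u)%MM)
    & (forall m, m != 0%MM -> lt 0%MM m)].

Definition LTs (l : nat) (lt : rel 'X_{1..l}) (f : {mpoly int[l]}) : 'X_{1..l} :=
  foldr (fun m acc => if lt acc m then m else acc) 0%MM (msupp f).

Definition LCs (l : nat) (lt : rel 'X_{1..l}) (f : {mpoly int[l]}) : int :=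
  f@_(LTs lt f).

Definition LMdvd (l : nat) (lt : rel 'X_{1..l}) (g f : {mpoly int[l]}) : bool :=
  (LCs lt g %| LCs lt f)%Z && (LTs lt g <= LTs lt f)%MM.

Definition in_ideal (l : nat) (gs : seq {mpoly int[l]}) (f : {mpoly int[l]}) : Prop :=
  exists cs : seq {mpoly int[l]}, f = \sum_(i < size gs) cs`_i * gs`_i.

Definition min_strong_GB (l : nat) (lt : rel 'X_{1..l})
  (gens G : seq {mpoly int[l]}) : Prop :=
  [/\ uniq G,
      (forall g, g \in G -> g != 0),
      (forall f, in_ideal G f <-> in_ideal gens f),
      (forall f, in_ideal gens f -> f != 0 -> exists2 g, g \in G & LMdvd lt g f)
    & (forall g g', g \in G -> g' \in G -> g != g' -> ~~ LMdvd lt g g')].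

Definition sigma_lucky (l : nat) (lt : rel 'X_{1..l})
  (gens : seq {mpoly int[l]}) (p : nat) : Prop :=
  exists G, min_strong_GB lt gens G /\
    forall g, g \in G -> ~ (p%:Z %| LCs lt g)%Z.

Definition sigma_k_lucky (l n : nat) (lt : rel 'X_{1..l})
  (alpha : 'I_n -> 'rV[int]_l) (k p : nat) : Prop :=
  forall S : {set 'I_n}, #|S| = k -> (l - dimI rat alpha S)%N = k ->
    sigma_lucky lt [seq lform (alpha i) | i <- enum S] p.

(* Main.v *)
(* For a set S of linear forms let A_S be the integer matrix with rows alpha_i,
   i in S; its row lattice is the degree-one part of the ideal I_S.

   If A_S is a basis over Q and p is lucky for I_S, the row lattice is
   p-saturated: when p b lies in it, the leading monomial of p b is divisible by
   that of some basis element g, whose linear part is in the lattice; as p does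
   not divide LC(g), subtracting a multiple of that linear part from b lowers its
   leading term.  Saturation says that A_S keeps full rank mod p, and since any
   independent family extends to a basis, all ranks are preserved mod p.

   Conversely, if A_S has rank l mod p, some D prime to p satisfies D x_j in I_S
   for all j, hence D m in I_S for every monomial m <> 1, and by minimality every
   leading coefficient of a minimal strong basis divides D.  Such a basis exists
   by Dickson's lemma. *)

Require Import Defs.
From HB Require Import structures.
From Stdlib Require Import Classical.
From mathcomp Require Import all_boot all_order all_algebra.
From mathcomp Require Import mpoly.
From mathcomp Require Import zify.
Set Implicit Arguments. Unset Strict Implicit. Unset Printing Implicit Defensive.
Import Order.TTheory GRing.Theory Num.Theory.
Local Open Scope ring_scope.

(** * Dickson's lemma *)

Lemma finite_choice (T : Type) (x0 : T) (I : eqType) (r : seq I)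
    (P : I -> T -> Prop) :
  (forall i, i \in r -> exists x, P i x) ->
  exists F : I -> T, forall i, i \in r -> P i (F i).
Proof.
elim: r => [_|i r IHr Px]; first by exists (fun=> x0).
have [x Pix] := Px i (mem_head _ _).
have [j jr|F PF] := IHr; first by apply: Px; rewrite inE jr orbT.
exists (fun j => if j == i then x else F j) => j.
by rewrite inE; case: eqP => [-> _|_] //=; apply: PF.
Qed.

(** Induction on the number of coordinates. A basis [B0] for the first k coordinates serves every t
    whose coordinate k is at least the maximum [N] over [B0]; the other t lie in the finitely many
    slices [c k t = j] with j < [N], and each slice has its own basis. *)
Lemma dickson (T : eqType) (c : nat -> T -> nat) (k : nat) (P : T -> Prop) :
  exists2 B : seq T, (forall b, b \in B -> P b) &
    forall t, P t -> exists2 b, b \in B & forall i, (i < k)%N -> (c i b <= c i t)%N.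
Proof.
elim: k P => [|k IHk] P.
  have [[t Pt]|nP] := classic (exists t, P t).
    exists [:: t] => [b|u _]; first by rewrite inE => /eqP->.
    by exists t; rewrite ?mem_head.
  by exists [::] => // t Pt; case: nP; exists t.
have [B0 PB0 B0min] := IHk P.
pose N := \max_(b <- B0) c k b.
have [F PF] : exists F : nat -> seq T, forall j, j \in iota 0 N ->
    (forall b, b \in F j -> P b /\ c k b = j) /\
    forall t, P t /\ c k t = j ->
      exists2 b, b \in F j & forall i, (i < k)%N -> (c i b <= c i t)%N.
  apply: (@finite_choice _ [::] _ _ (fun j B =>
    (forall b, b \in B -> P b /\ c k b = j) /\
    forall t, P t /\ c k t = j ->
      exists2 b, b \in B & forall i, (i < k)%N -> (c i b <= c i t)%N)) => j _.
  have [B PB Bmin] := IHk (fun t => P t /\ c k t = j).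
  by exists B; split.
exists (B0 ++ flatten [seq F j | j <- iota 0 N]) => [b|t Pt].
  rewrite mem_cat => /orP[/PB0 //|/flattenP[_ /mapP[j jN ->]]].
  by have [PFj _] := PF j jN => /PFj[].
have [Nt|tN] := leqP N (c k t).
  have [b bB0 bt] := B0min t Pt.
  exists b; first by rewrite mem_cat bB0.
  move=> i; rewrite ltnS leq_eqVlt => /predU1P[->|/bt//].
  by apply: leq_trans Nt; rewrite /N (big_rem b) //= leq_maxl.
have jN : c k t \in iota 0 N by rewrite mem_iota.
have [PFj Fmin] := PF _ jN.
have [b bF bt] := Fmin t (conj Pt erefl); exists b.
  by rewrite mem_cat; apply/orP; right; apply/flattenP; exists (F (c k t));
     rewrite ?map_f.
move=> i; rewrite ltnS leq_eqVlt => /predU1P[->|/bt//].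
by have [_ ->] := PFj b bF.
Qed.

(** * Term orderings and leading monomials *)

Section TermOrder.

Variables (l : nat) (lt : rel 'X_{1..l}).
Hypothesis ltP : term_order lt.

Lemma to_irr m : lt m m = false. Proof. by case: ltP => /(_ m). Qed.

Lemma to_trans : transitive lt. Proof. by case: ltP. Qed.

Lemma to_total m1 m2 : [\/ m1 = m2, lt m1 m2 | lt m2 m1].
Proof.
case: ltP => _ _ tot _ _; have [->|/tot/orP[]] := eqVneq m1 m2.
- by constructor 1.
- by constructor 2.
- by constructor 3.
Qed.

Lemma to_add m1 m2 u : lt m1 m2 -> lt (m1 + u)%MM (m2 + u)%MM.
Proof. by case: ltP => _ _ _ + _; apply. Qed.

Lemma to_lt0 m : lt m 0%MM = false.
Proof.
case: ltP => irr tr _ _ pos; apply/negP => m0.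
have [m_0|/pos m_gt0] := eqVneq m 0%MM; first by rewrite m_0 irr in m0.
by have := tr _ _ _ m0 m_gt0; rewrite irr.
Qed.

Lemma to_le m1 m2 : (m1 <= m2)%MM -> m1 != m2 -> lt m1 m2.
Proof.
move=> le12 ne12; rewrite -[m1]add0m -(submK le12).
apply: to_add; case: ltP => _ _ _ _; apply; apply: contra ne12 => /eqP d0.
by rewrite -(submK le12) d0 add0m.
Qed.

Lemma mnm_dickson (T : eqType) (f : T -> 'X_{1..l}) (c : T -> nat) (P : T -> Prop) :
  exists2 B : seq T, (forall b, b \in B -> P b) &
    forall t, P t -> exists2 b, b \in B & (f b <= f t)%MM /\ (c b <= c t)%N.
Proof.
(* Indices below [l] give the exponents; at index [l], where [insub] fails, sits the extra
   coordinate [c]. *)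
pose d i t := if insub i is Some j then f t j else c t.
have [B PB Bmin] := dickson d l.+1 P.
exists B => // t /Bmin[b bB le_bt]; exists b => //; split.
  apply/mnm_lepP => i; have := le_bt i (ltnW (ltn_ord i)).
  by rewrite /d valK.
by have := le_bt l (leqnn _); rewrite /d insubF ?ltnn.
Qed.

(** A Dickson basis of the inaccessible monomials has an [lt]-least member b. An inaccessible m'
    below b would be a multiple of some basis member b', which would then lie below b. *)
Lemma to_wf : well_founded lt.
Proof.
move=> m; apply: NNPP => nacc.
have [B PB Bmin] := mnm_dickson id (fun=> 0%N) (fun m => ~ Acc lt m).
have [b0 b0B _] := Bmin m nacc.
have [b bB bmin] : exists2 b, b \in B & forall b', b' \in B -> ~~ lt b' b.
  elim: (B) b0 b0B => {m nacc PB Bmin} // b1 B' IH b0 _.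
  case: B' IH => [_|b2 B' IH].
    by exists b1; rewrite ?mem_head // => b'; rewrite inE => /eqP->; rewrite to_irr.
  have [b bB' bmin] := IH b2 (mem_head _ _).
  have [ltb1|nltb1] := boolP (lt b1 b).
    exists b1; rewrite ?mem_head // => b'.
    rewrite inE => /predU1P[->|/bmin]; first by rewrite to_irr.
    by apply: contra => /to_trans; apply.
  exists b; first by rewrite inE bB' orbT.
  by move=> b'; rewrite inE => /predU1P[->|/bmin].
apply: (PB b bB); constructor => m' lt_m'b; apply: NNPP => nacc'.
have [b' b'B [le_b'm' _]] := Bmin m' nacc'.
have := bmin b' b'B; have [->|ne] := eqVneq b' m'; first by rewrite lt_m'b.
by rewrite (to_trans (to_le le_b'm' ne) lt_m'b).
Qed.

Local Notation LT := (LTs lt).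
Local Notation LC := (LCs lt).
Implicit Types f g : {mpoly int[l]}.

Lemma LTs_seq (s : seq 'X_{1..l}) 
    (m := foldr (fun m acc => if lt acc m then m else acc) 0%MM s) :
  (m \in s \/ m = 0%MM) /\ forall m', m' \in s -> m' = m \/ lt m' m.
Proof.
rewrite {}/m; elim: s => [|a s [IH1 IH2]] /=; first by split; [right|].
set m := foldr _ _ _ in IH1 IH2 *; case: ifP => [ltma|nltma]; split.
- by left; rewrite mem_head.
- move=> m'; rewrite inE => /predU1P[->|/IH2[->|lt_m'm]]; [by left|by right|].
  by right; apply: to_trans ltma.
- by case: IH1 => [ms|->]; [left; rewrite inE ms orbT|right].
- move=> m'; rewrite inE => /predU1P[->|/IH2//].
  by case: (to_total a m) => [|?|]; [left|right|rewrite nltma].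
Qed.

(** The fold in [LTs] starts from the monomial 0. If it returns this default, every monomial in the
    nonempty support equals 0, as nothing lies below 0, so the default is in the support after
    all. *)
Lemma LCs_neq0 f : f != 0 -> LC f != 0.
Proof.
move=> f0; have [] := LTs_seq (msupp f); rewrite -/(LT f) /LCs -mcoeff_msupp.
case=> // -> max; case fs: (msupp f) => [|m s]; first by rewrite -msupp_eq0 fs in f0.
have ms : m \in msupp f by rewrite fs mem_head.
by case: (max m ms) => [m0|]; [rewrite -fs -m0|rewrite to_lt0].
Qed.

Lemma lt_LTs f m : f@_m != 0 -> m != LT f -> lt m (LT f).
Proof.
rewrite -mcoeff_msupp; have [_ max] := LTs_seq (msupp f).
by case/max => [->|//]; rewrite eqxx.
Qed.

(** The coefficient at [m] may vanish, so the property survives sums in which leading monomials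
    cancel. *)
Definition below m f := forall m', f@_m' != 0 -> m' != m -> lt m' m.

Lemma LTs_uniq f m : f@_m != 0 -> below m f -> LT f = m.
Proof.
move=> fm max; apply: contraTeq isT => ne.
have f0 : f != 0 by apply: contraNneq fm => ->; rewrite mcoeff0.
have l1 := max _ (LCs_neq0 f0) ne.
have l2 := lt_LTs fm; rewrite eq_sym in ne.
by have := to_trans l1 (l2 ne); rewrite to_irr.
Qed.

Lemma below_LTs f : below (LT f) f. Proof. by move=> m'; apply: lt_LTs. Qed.

Lemma belowD m f g : below m f -> below m g -> below m (f + g).
Proof.
move=> bf bg m'; rewrite mcoeffD => fg0; have [f0|/bf//] := eqVneq f@_m' 0.
by apply: bg; rewrite f0 add0r in fg0.
Qed.

Lemma belowZ m c f : below m f -> below m (c *: f).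
Proof.
by move=> bf m'; rewrite mcoeffZ mulf_eq0 => /norP[_]; apply: bf.
Qed.

Lemma mcoeffMX_neq0 f u m : (f * 'X_[u])@_m != 0 ->
  exists2 m', f@_m' != 0 & m = (u + m')%MM.
Proof.
rewrite -mcoeff_msupp (perm_mem (msuppMX _ _)) => /mapP[m' fm' ->].
by exists m'; rewrite -?mcoeff_msupp.
Qed.

Lemma belowMX m f u : below m f -> below (u + m)%MM (f * 'X_[u]).
Proof.
move=> bf m' /mcoeffMX_neq0[m1 fm1 ->] ne.
rewrite ![(u + _)%MM]addmC; apply/to_add/bf => //.
by apply: contra ne => /eqP->.
Qed.

Lemma LTs_below_lt m f : f != 0 -> f@_m = 0 -> below m f -> lt (LT f) m.
Proof.
move=> f0 fm bf; apply: bf; first exact: LCs_neq0.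
by apply: contraNneq (LCs_neq0 f0) => LTm; rewrite /LCs LTm fm.
Qed.

(** * Ideals given by generators *)

Lemma in_idealP gs f : in_ideal gs f <->
  exists c : 'I_(size gs) -> {mpoly int[l]}, f = \sum_i c i * gs`_i.
Proof.
split=> [[cs ->]|[c ->]]; first by exists (fun i : 'I__ => cs`_i).
exists [seq c i | i <- enum 'I_(size gs)]; apply: eq_bigr => i _.
by rewrite (nth_map i) ?size_enum_ord // nth_ord_enum.
Qed.

Lemma in_idealD gs f g : in_ideal gs f -> in_ideal gs g -> in_ideal gs (f + g).
Proof.
move=> /in_idealP[c ->] /in_idealP[d ->]; apply/in_idealP.
by exists (fun i => c i + d i); rewrite -big_split; apply: eq_bigr => i _; rewrite mulrDl.
Qed.

Lemma in_idealM gs f g : in_ideal gs f -> in_ideal gs (g * f).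
Proof.
move=> /in_idealP[c ->]; apply/in_idealP; exists (fun i => g * c i).
by rewrite mulr_sumr; apply: eq_bigr => i _; rewrite mulrA.
Qed.

Lemma in_idealMr gs f g : in_ideal gs f -> in_ideal gs (f * g).
Proof. by rewrite mulrC; apply: in_idealM. Qed.

Lemma in_idealZ gs f c : in_ideal gs f -> in_ideal gs (c *: f).
Proof. by rewrite -mul_mpolyC; apply: in_idealM. Qed.

Lemma in_idealB gs f g : in_ideal gs f -> in_ideal gs g -> in_ideal gs (f - g).
Proof. by move=> If Ig; apply: in_idealD => //; rewrite -scaleN1r; apply: in_idealZ. Qed.

Lemma in_ideal0 (gs : seq {mpoly int[l]}) : in_ideal gs 0.
Proof. by apply/in_idealP; exists (fun=> 0); rewrite big1 // => i _; rewrite mul0r. Qed.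

Lemma in_ideal_gen gs g : g \in gs -> in_ideal gs g.
Proof.
move=> gG; have lt_i : (index g gs < size gs)%N by rewrite index_mem.
apply/in_idealP; exists (fun i => (i == Ordinal lt_i)%:R).
rewrite (bigD1 (Ordinal lt_i)) //= eqxx mul1r nth_index // big1 ?addr0 // => i.
by move=> /negbTE->; rewrite mul0r.
Qed.

Lemma in_ideal_sub gs hs f : (forall g, g \in gs -> in_ideal hs g) ->
  in_ideal gs f -> in_ideal hs f.
Proof.
move=> sub /in_idealP[c ->]; elim/big_rec: _ => [|i h _ Ih]; first exact: in_ideal0.
by apply: in_idealD => //; apply/in_idealM/sub/mem_nth.
Qed.

Lemma LMdvd_trans g f h : LMdvd lt f g -> LMdvd lt g h -> LMdvd lt f h.
Proof.
by move=> /andP[c1 t1] /andP[c2 t2]; rewrite /LMdvd (dvdz_trans c1 c2) (lepm_trans t1 t2).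
Qed.

(** * Strong Gröbner bases over the integers *)

Definition strong_GB (gens G : seq {mpoly int[l]}) :=
  (forall g, g \in G -> in_ideal gens g /\ g != 0) /\
  forall f, in_ideal gens f -> f != 0 -> exists2 g, g \in G & LMdvd lt g f.

(* The absolute value of the leading coefficient is added as an extra Dickson
   coordinate; when LC b does not divide LC f, Euclidean division yields an
   element of the ideal with the same leading term and smaller coefficient. *)
Lemma strong_GB_exists gens : exists G, strong_GB gens G.
Proof.
have [B PB Bmin] := mnm_dickson LT (fun f => `|LC f|%N)
  (fun f => in_ideal gens f /\ f != 0).
exists B; split=> // f If f0.
(* Descent on the size of [LC h]. The element [h] only serves to select [b]; it is always [f] that
   gets divided, and the remainder becomes the next [h]. *)
suff: forall N h, (`|LC h| < N)%N -> in_ideal gens h -> h != 0 -> LT h = LT f ->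
    exists2 g, g \in B & LMdvd lt g f by move/(_ _ f (leqnn _)); apply.
elim=> // N IH h hN Ih h0 LThf.
have [b bB [bh1 bh2]] := Bmin h (conj Ih h0).
rewrite LThf in bh1; have [Ib b0] := PB b bB.
have [dvd|ndvd] := boolP (LC b %| LC f)%Z; first by exists b; rewrite // /LMdvd dvd.
pose u := (LT f - LT b)%MM.
pose h' := f - (LC f %/ LC b)%Z *: (b * 'X_[u]).
have h'E : h'@_(LT f) = (LC f %% LC b)%Z.
  rewrite mcoeffB mcoeffZ -{2}(submK bh1) mcoeffMX -!/(LC _).
  by rewrite {1}(divz_eq (LC f) (LC b)) [_ * _ + _]addrC addrK.
have h'nz : h'@_(LT f) != 0.
  by rewrite h'E; apply: contra ndvd => /eqP r0; apply/dvdz_mod0P.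
have bel : below (LT f) h'.
  apply: belowD; first exact: below_LTs.
  rewrite -scaleNr; apply: belowZ; rewrite -{1}(submK bh1).
  exact/belowMX/below_LTs.
have LTh' := LTs_uniq h'nz bel.
apply: (IH h') => //.
- rewrite /LCs LTh' h'E -ltz_nat; apply: lt_le_trans (_ : `|LC b|%:Z <= _).
    by rewrite gez0_abs ?modz_ge0 ?ltz_mod ?LCs_neq0 //; rewrite abszE ltz_mod ?LCs_neq0.
  by rewrite lez_nat (leq_trans bh2).
- by apply/in_idealB/in_idealZ/in_idealMr.
- by apply: contraNneq h'nz => ->; rewrite mcoeff0.
Qed.

(** Members whose leading monomial is a multiple of another member's are discarded one by one;
    transitivity of [LMdvd] keeps the basis strong. *)
Lemma minimal_strong_GB_exists gens : exists G, [/\ strong_GB gens G, uniq G &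
  forall g g', g \in G -> g' \in G -> g != g' -> ~~ LMdvd lt g g'].
Proof.
have [G0 [G0I G0S]] := strong_GB_exists gens.
have {G0I G0S} : strong_GB gens (undup G0).
  split=> [g|f If f0]; first by rewrite mem_undup; apply: G0I.
  by have [g] := G0S f If f0; exists g; rewrite ?mem_undup.
have := undup_uniq G0; move: (undup G0) => {G0} G.
elim: {G}(size G) {-2}G (leqnn (size G)) => [|N IH] G sG uG [GI GS].
  exists [::]; split=> //; split=> // f If f0; have [g] := GS f If f0.
  by rewrite leqn0 size_eq0 in sG; rewrite (eqP sG).
pose red x := has (fun y => (y != x) && LMdvd lt y x) G.
have [/hasP[x xG /hasP[y yG /andP[nyx yx]]]|/hasPn nred] := boolP (has red G).
  apply: (IH (rem x G)); rewrite ?rem_uniq //.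
    rewrite size_rem // -ltnS (leq_trans _ sG) // prednK // lt0n size_eq0.
    by case: (G) xG.
  split=> [g /mem_rem/GI//|f If f0]; have [g gG gf] := GS f If f0.
  have [gx|ngx] := eqVneq g x.
    by exists y; rewrite ?mem_rem_uniq ?inE ?nyx // (LMdvd_trans yx) -?gx.
  by exists g; rewrite ?mem_rem_uniq ?inE ?ngx.
exists G; split=> // g g' gG g'G ne.
by have /hasPn/(_ g gG) := nred g' g'G; rewrite ne.
Qed.

(** Division algorithm: a multiple of some g cancels the leading monomial of f entirely, and the
    term ordering is well-founded. *)
Lemma strong_GB_generates gens G f : strong_GB gens G -> in_ideal gens f -> in_ideal G f.
Proof.
move=> [GI GS]; have [->|f0] := eqVneq f 0; first by move=> _; apply: in_ideal0.
move: {2}(LT f) (erefl (LT f)) => m.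
elim/(well_founded_ind to_wf): m f f0 => m IH f f0 LTf If.
have [g gG /andP[/dvdzP[c ceq] tdiv]] := GS f If f0.
pose h := c *: (g * 'X_[LT f - LT g]).
have Ih hs : in_ideal hs g -> in_ideal hs h by move=> Ig; apply/in_idealZ/in_idealMr.
have bel : below (LT f) (f - h).
  apply: belowD; first exact: below_LTs.
  rewrite -scaleNr; apply: belowZ; rewrite -{1}(submK tdiv).
  exact/belowMX/below_LTs.
have fh0 : (f - h)@_(LT f) = 0.
  by rewrite mcoeffB mcoeffZ -{2}(submK tdiv) mcoeffMX -!/(LC _) ceq subrr.
rewrite -(subrK h f); apply: in_idealD; last exact/Ih/in_ideal_gen.
have [->|fh_nz] := eqVneq (f - h) 0; first exact: in_ideal0.
apply: (IH (LT (f - h))) => //; first by rewrite -LTf LTs_below_lt.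
by apply: in_idealB => //; have [/Ih] := GI g gG.
Qed.

Lemma min_strong_GB_exists gens : exists G, min_strong_GB lt gens G.
Proof.
have [G [SG uG minG]] := minimal_strong_GB_exists gens; have [GI GS] := SG.
exists G; split=> // [g /GI[]//|f]; split; last exact: strong_GB_generates.
by apply: in_ideal_sub => g /GI[].
Qed.

(** A Bezout combination of g and h has leading term [LT g] and leading coefficient gcd([LC g],
    [LC h]). A basis member whose leading monomial divides that one also divides [LM g], so by
    minimality it is g. *)
Lemma min_strong_GB_LC_dvd gens G g h : min_strong_GB lt gens G -> g \in G ->
  in_ideal gens h -> h != 0 -> LT h = LT g -> (LC g %| LC h)%Z.
Proof.
move=> [uG G0 GE GS Gmin] gG Ih h0 LThg.
have Ig : in_ideal gens g by apply/GE/in_ideal_gen.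
have [u [v uv]] := Bezoutz (LC g) (LC h).
have hE : (u *: g + v *: h)@_(LT g) = gcdz (LC g) (LC h).
  by rewrite mcoeffD !mcoeffZ -{2}LThg -!/(LC _) uv.
have hnz : (u *: g + v *: h)@_(LT g) != 0.
  by rewrite hE gcdz_eq0 negb_and LCs_neq0 ?G0.
have LTd : LT (u *: g + v *: h) = LT g.
  apply: LTs_uniq hnz _; apply: belowD; apply: belowZ; first exact: below_LTs.
  by rewrite -LThg; apply: below_LTs.
have [||g' g'G /andP[]] := GS (u *: g + v *: h).
- by apply: in_idealD; apply: in_idealZ.
- by apply: contraNneq hnz => ->; rewrite mcoeff0.
rewrite /LCs LTd hE -!/(LC _) dvdz_gcd => /andP[g'g g'h] tdiv.
suff /eqP <- : g' == g by [].
by apply: contraT => /(Gmin _ _ g'G gG); rewrite /LMdvd g'g tdiv.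
Qed.

End TermOrder.

(** * Independent families and the spans they generate *)

Section Span.

Variables (F : fieldType) (I : finType) (l : nat) (v : I -> 'rV[F]_l).

Definition fam_span (S : {set I}) : 'M_l := (\sum_(i in S) <<v i>>)%MS.

Definition indep (S : {set I}) := \rank (fam_span S) == #|S|.

Lemma fam_spanS (S T : {set I}) : S \subset T -> (fam_span S <= fam_span T)%MS.
Proof.
by move=> /subsetP sST; apply/sumsmx_subP => i /sST iT; apply: (sumsmx_sup i).
Qed.

Lemma fam_spanU (S T : {set I}) :
  (fam_span (S :|: T) <= fam_span S + fam_span T)%MS.
Proof.
apply/sumsmx_subP => i; rewrite inE => /orP[iS|iT].
  exact: submx_trans (sumsmx_sup i _ _) (addsmxSl _ _).
exact: submx_trans (sumsmx_sup i _ _) (addsmxSr _ _).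
Qed.

Lemma rank_fam_span (S : {set I}) : (\rank (fam_span S) <= #|S|)%N.
Proof.
apply: leq_trans (mxrank_sum_leqif _) _ => /=.
by rewrite -sum1_card leq_sum // => i _; rewrite genmxE rank_leq_row.
Qed.

Lemma indep0 : indep set0.
Proof. by rewrite /indep /fam_span big_set0 mxrank0 cards0. Qed.

(** By subadditivity of rank, |S| is at most rank(T) + |S \ T|, which forces rank(T) to be at least
    |T|. *)
Lemma indep_sub (S T : {set I}) : T \subset S -> indep S -> indep T.
Proof.
move=> sTS /eqP iS; rewrite /indep eqn_leq rank_fam_span /=.
rewrite -(leq_add2r #|S :\: T|) -{1}(setIidPr sTS) cardsID -iS.
have SE : T :|: (S :\: T) = S by rewrite -{1}(setIidPr sTS) setID.
have /mxrankS := fam_spanU T (S :\: T); rewrite SE => /leq_trans; apply.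
by apply: leq_trans (mxrank_adds_leqif _ _) _; rewrite leq_add2l rank_fam_span.
Qed.

(** Take B maximal among the independent subsets of S containing T: a vector of S outside the span
    of B could be added to it. *)
Lemma indep_extend (S T : {set I}) : T \subset S -> indep T ->
  exists B : {set I}, [/\ T \subset B, B \subset S, indep B
                        & \rank (fam_span S) = #|B|].
Proof.
move=> sTS iT; pose P B := indep B && (B \subset S).
have [|B /maxsetP[/andP[iB sBS] Bmax] sTB] := @maxset_exists _ P T.
  by rewrite /P iT.
exists B; split=> //; apply/eqP; rewrite -(eqP iB) eqn_leq.
rewrite [X in _ && X]mxrankS ?fam_spanS // andbT.
rewrite mxrankS //; apply/sumsmx_subP => i iS; apply: contraT => niB.
have iNB : i \notin B by apply: contra niB => iB'; apply: (sumsmx_sup i).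
suff iiB : P (i |: B).
  by have /setP/(_ i) := Bmax _ iiB (subsetUr _ _); rewrite !inE eqxx (negbTE iNB).
rewrite /P subUset sub1set iS sBS /= andbT /indep eqn_leq rank_fam_span /=.
rewrite cardsU1 iNB -(eqP iB) ltnNge; apply: contra niB => le_rank.
have sB : (fam_span B <= fam_span (i |: B))%MS by rewrite fam_spanS ?subsetUr.
apply: submx_trans (_ : (fam_span (i |: B) <= _)%MS).
  by apply: (sumsmx_sup i); rewrite ?setU11.
by rewrite -(geq_leqif (mxrank_leqif_sup sB)).
Qed.

End Span.

(** * Integer matrices and their reduction mod p *)

Section ModP.

Variable p : nat.
Hypothesis p_pr : prime p.

Lemma intr_Fp_eq0 (z : int) : (z%:~R == 0 :> 'F_p) = (p %| z)%Z.
Proof. by rewrite -(dvdz_pcharf (pchar_Fp p_pr)). Qed.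

Definition liftFp (x : 'F_p) : int := (x : nat)%:Z.

Lemma liftFpK (x : 'F_p) : (liftFp x)%:~R = x.
Proof. exact: natr_Zp. Qed.

Lemma map_liftFpK m n (A : 'M['F_p]_(m, n)) : map_mx intr (map_mx liftFp A) = A.
Proof. by apply/matrixP => i j; rewrite !mxE liftFpK. Qed.

(** A lift of a right inverse mod p gives a square product of determinant 1 mod p; its adjugate
    turns that product into a scalar prime to p, with no denominators. *)
Lemma int_right_inverse m n (A : 'M[int]_(m, n)) :
  row_free (map_mx intr A : 'M['F_p]_(m, n)) ->
  exists B : 'M[int]_(n, m), exists2 D : int, ~~ (p %| D)%Z & A *m B = D%:M.
Proof.
move=> /row_freeP[B AB]; pose M := A *m map_mx liftFp B.
exists (map_mx liftFp B *m \adj M), (\det M); last by rewrite mulmxA mul_mx_adj.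
rewrite -intr_Fp_eq0 -det_map_mx map_mxM map_liftFpK AB det1; exact: oner_neq0.
Qed.

Lemma int_left_inverse m n (A : 'M[int]_(m, n)) :
  row_full (map_mx intr A : 'M['F_p]_(m, n)) ->
  exists B : 'M[int]_(n, m), exists2 D : int, ~~ (p %| D)%Z & B *m A = D%:M.
Proof.
rewrite /row_full -mxrank_tr matrix.map_trmx => /int_right_inverse[B [D pD AB]].
by exists B^T, D; rewrite // -[A]trmxK -trmx_mul AB tr_scalar_mx.
Qed.

Lemma row_free_Fp_rat m n (A : 'M[int]_(m, n)) :
  row_free (map_mx intr A : 'M['F_p]_(m, n)) ->
  row_free (map_mx intr A : 'M[rat]_(m, n)).
Proof.
move=> /int_right_inverse[B [D pD AB]]; apply/row_freeP.
exists (D%:~R^-1 *: map_mx intr B); rewrite -scalemxAr -map_mxM AB map_scalar_mx.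
rewrite scale_scalar_mx mulVf // intr_eq0.
by apply: contra pD => /eqP->; rewrite dvdz0.
Qed.

(** Lift a kernel vector v mod p to c. Then cA = pb, saturation gives b = e'A, and independence over
    Q gives c = pe', so v = 0. *)
Lemma saturated_row_free m n (A : 'M[int]_(m, n)) :
  row_free (map_mx intr A : 'M[rat]_(m, n)) ->
  (forall (b : 'rV_n) (e : 'rV_m), e *m A = p%:Z *: b ->
    exists e' : 'rV_m, b = e' *m A) ->
  row_free (map_mx intr A : 'M['F_p]_(m, n)).
Proof.
move=> Afree sat; rewrite -kermx_eq0; apply/rowV0P => v /sub_kermxP vA.
pose c := map_mx liftFp v.
have cA : p%:Z *: map_mx (fun z => z %/ p%:Z)%Z (c *m A) = c *m A.
  apply/rowP => j; rewrite mxE [X in _ * X]mxE mulrC divzK //.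
  rewrite -intr_Fp_eq0; have /rowP/(_ j) := vA.
  by rewrite -[v]map_liftFpK -map_mxM !mxE => ->.
have [e ce] : exists e, c = p%:Z *: e.
  have [e' be'] := sat _ _ (esym cA).
  exists e'; have : map_mx intr c = map_mx intr (p%:Z *: e') :> 'rV[rat]_m.
    by apply: (row_free_inj Afree); rewrite -!map_mxM -cA be' scalemxAl.
  by move/rowP=> eqc; apply/rowP => j; have := eqc j; rewrite !mxE => /intr_inj.
rewrite -[v]map_liftFpK -/c ce; apply/rowP => j; rewrite !mxE.
by apply/eqP; rewrite intr_Fp_eq0 dvdz_mulr.
Qed.

End ModP.

(** * Linear forms as polynomials *)

Section Forms.

Variable l : nat.
Implicit Types (a b : 'rV[int]_l) (f g : {mpoly int[l]}).

Lemma mcoeff_lform a m : (lform a)@_m = \sum_j a ord0 j * (U_(j)%MM == m)%:R.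
Proof.
by rewrite raddf_sum; apply: eq_bigr => j _ /=; rewrite mcoeffCM mcoeffX.
Qed.

Lemma mcoeff_lformU a j : (lform a)@_U_(j) = a ord0 j.
Proof.
rewrite mcoeff_lform (bigD1 j) //= eqxx mulr1 big1 ?addr0 // => i ne.
by rewrite eq_mnm1 (negbTE ne) mulr0.
Qed.

Lemma mcoeff_lform0 a : (lform a)@_0%MM = 0.
Proof. by rewrite mcoeff_lform big1 // => j _; rewrite mnm1_eq0 mulr0. Qed.

Lemma mcoeff_lform_neq0 a m : (lform a)@_m != 0 ->
  exists2 j, m = U_(j)%MM & a ord0 j != 0.
Proof.
move=> am; have [j /eqP mj|nj] := pickP (fun j => U_(j)%MM == m).
  by exists j; rewrite // -mcoeff_lformU mj.
by case/eqP: am; rewrite mcoeff_lform big1 // => j _; rewrite nj mulr0.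
Qed.

Lemma lform_eq0 a : (lform a == 0) = (a == 0).
Proof.
apply/eqP/eqP => [a0|->].
  by apply/rowP => j; rewrite mxE -[LHS]mcoeff_lformU a0 mcoeff0.
by rewrite /lform big1 // => j _; rewrite mxE mpolyC0 mul0r.
Qed.

Lemma lformZ c a : lform (c *: a) = c *: lform a.
Proof.
by rewrite scaler_sumr; apply: eq_bigr => j _; rewrite mxE mpolyCM -mulrA mul_mpolyC.
Qed.

Lemma lform_delta j : lform (delta_mx ord0 j : 'rV_l) = 'X_j.
Proof.
rewrite /lform (bigD1 j) //= big1 => [|i /negbTE ne]; rewrite mxE.
  by rewrite !eqxx mul1r addr0.
by rewrite ne andbF mpolyC0 mul0r.
Qed.

Lemma lform_mulmx m (e : 'rV[int]_m) (A : 'M_(m, l)) :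
  lform (e *m A) = \sum_i e ord0 i *: lform (row i A).
Proof.
rewrite /lform; under eq_bigr do rewrite mxE raddf_sum mulr_suml.
rewrite exchange_big; apply: eq_bigr => i _; rewrite scaler_sumr.
by apply: eq_bigr => j _ /=; rewrite mxE mpolyCM -mulrA mul_mpolyC.
Qed.

Definition linpart f : 'rV[int]_l := \row_j f@_U_(j).

Lemma linpartM f a : linpart (f * lform a) = f@_0%MM *: a.
Proof.
apply/rowP => j; rewrite !mxE -[U_(j)%MM]add0m.
(* Product rule at the origin, where [lform a] vanishes. *)
have -> : (f * lform a)@_(0 + U_(j)) = ((f * lform a)^`M(j))@_0%MM.
  by rewrite mcoeff_deriv mnm0E mulr1n.
rewrite mderivM mcoeffD !rmorphM /= mcoeff_lform0 mulr0 add0r.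
by rewrite mcoeff_deriv add0m mnm0E mulr1n mcoeff_lformU.
Qed.

End Forms.

(** * Ideals of subfamilies: saturation and luckiness *)

Section Arrangement.

Variables (l n : nat) (alpha : 'I_n -> 'rV[int]_l).
Implicit Types S T : {set 'I_n}.

Definition forms_mx S : 'M[int]_(#|S|, l) := \matrix_i alpha (enum_val i).

Local Notation gens S := [seq lform (alpha i) | i <- enum S].
Local Notation forms_in F S := (map_mx intr (forms_mx S) : 'M[F]_(_, _)).

Lemma row_forms_in (F : fieldType) S i :
  row i (forms_in F S) = redF F (alpha (enum_val i)).
Proof. by apply/rowP => j; rewrite !mxE. Qed.

Lemma fam_span_forms (F : fieldType) S :
  (fam_span (fun i => redF F (alpha i)) S :=: forms_in F S)%MS.
Proof.
apply/eqmxP; apply/andP; split.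
  apply/sumsmx_subP => i iS; rewrite genmxE.
  by rewrite -(enum_rankK_in iS iS) -row_forms_in row_sub.
apply/row_subP => i; rewrite row_forms_in.
by rewrite (sumsmx_sup (enum_val i)) ?enum_valP ?genmxE.
Qed.

Lemma dimI_forms (F : fieldType) S : dimI F alpha S = (l - \rank (forms_in F S))%N.
Proof.
rewrite -mxrank_tr -mxrank_ker; apply: eqmx_rank; apply/andP; split.
  apply/sub_kermxP/trmx_inj/row_matrixP => i.
  rewrite trmx_mul trmxK trmx0 row0 row_mul row_forms_in.
  apply: trmx_inj; rewrite trmx_mul trmxK trmx0.
  by apply/sub_kermxP; rewrite (bigcapmx_inf (enum_val i)) ?enum_valP.
apply/sub_bigcapmxP => i iS; apply/sub_kermxP.
have /(congr1 trmx) := mulmx_ker (forms_in F S)^T.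
rewrite trmx_mul trmxK trmx0 => /(congr1 (row (enum_rank_in iS i))).
rewrite row_mul row_forms_in enum_rankK_in // row0 => /(congr1 trmx).
by rewrite trmx_mul trmxK trmx0.
Qed.

Lemma indepE (F : fieldType) S :
  indep (fun i => redF F (alpha i)) S = row_free (forms_in F S).
Proof. by rewrite /indep fam_span_forms. Qed.

(** The generators have no constant term, so only the constant terms of the cofactors reach degree
    one; they are the integer coefficients collected in [e]. *)
Lemma in_ideal_linpart S f : in_ideal (gens S) f ->
  f@_0%MM = 0 /\ exists e, linpart f = e *m forms_mx S.
Proof.
move=> /in_idealP[c ->]; elim/big_rec: _ => [|i h _ [h0 [e he]]].
  rewrite mcoeff0; split=> //; exists 0; rewrite mul0mx.
  by apply/rowP => j; rewrite !mxE mcoeff0.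
have [k kS ->] : exists2 k, k \in S & (gens S)`_i = lform (alpha k).
  have : (gens S)`_i \in gens S by rewrite mem_nth.
  by case/mapP => k; rewrite mem_enum; exists k.
split; first by rewrite mcoeffD rmorphM /= mcoeff_lform0 mulr0 add0r.
exists ((c i)@_0%MM *: delta_mx 0 (enum_rank_in kS k) + e).
rewrite mulmxDl -scalemxAl -rowE -he.
have -> : row (enum_rank_in kS k) (forms_mx S) = alpha k.
  by apply/rowP => j; rewrite !mxE enum_rankK_in.
by rewrite -linpartM; apply/rowP => j; rewrite !mxE mcoeffD.
Qed.

Lemma in_ideal_lform S e : in_ideal (gens S) (lform (e *m forms_mx S)).
Proof.
rewrite lform_mulmx; elim/big_rec: _ => [|i h _ Ih]; first exact: in_ideal0.
apply: in_idealD => //; apply: in_idealZ; apply: in_ideal_gen.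
apply/mapP; exists (enum_val i); first by rewrite mem_enum enum_valP.
by congr lform; apply/rowP => j; rewrite !mxE.
Qed.

Variable lt : rel 'X_{1..l}.
Hypothesis ltP : term_order lt.

Variable p : nat.
Hypothesis p_pr : prime p.

Lemma mnm_neq0 (m : 'X_{1..l}) : m != 0%MM -> exists j, m j != 0%N.
Proof.
move=> m0; have [j mj|m_0] := pickP (fun j => m j != 0%N); first by exists j.
case/eqP: m0; apply/mnmP => j; rewrite mnm0E.
by have /negbFE/eqP := m_0 j.
Qed.

Lemma lem_mnm1 (m : 'X_{1..l}) j : (m <= U_(j))%MM -> m != 0%MM -> m = U_(j)%MM.
Proof.
move=> /mnm_lepP le_mj /mnm_neq0[i mi].
have le_m k : (m k <= (j == k))%N by rewrite -mnm1E le_mj.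
have ij : j = i by have := le_m i; case: eqP => // _; rewrite leqn0 (negbTE mi).
apply/mnmP => k; rewrite mnm1E; have := le_m k; case: eqP => [<-|_].
  by rewrite ij; case: (m i) mi => [|[]].
by case: (m k).
Qed.

Lemma LTs_gens_neq0 S g : in_ideal (gens S) g -> g != 0 -> LTs lt g != 0%MM.
Proof.
move=> Ig /(LCs_neq0 ltP); apply: contraNneq => LT0.
by rewrite /LCs LT0; case: (in_ideal_linpart Ig) => ->.
Qed.

Lemma lucky_saturated S (b : 'rV_l) (e : 'rV_#|S|) :
  sigma_lucky lt (gens S) p -> e *m forms_mx S = p%:Z *: b ->
  exists e', b = e' *m forms_mx S.
Proof.
move=> [G [[uG G0 GE GS Gmin] Gp]].
move: {2}(LTs lt (lform b)) (erefl (LTs lt (lform b))) => m.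
elim/(well_founded_ind (to_wf ltP)): m b e => m IH b e LTb eb.
have [->|b0] := eqVneq b 0; first by exists 0; rewrite mul0mx.
have lb0 : lform b != 0 by rewrite lform_eq0.
have p0 : p%:Z != 0 by rewrite eqz_nat -lt0n prime_gt0.
have [j mj bj] := mcoeff_lform_neq0 (LCs_neq0 ltP lb0).
have pbj : (lform (p%:Z *: b))@_U_(j) != 0 by rewrite mcoeff_lformU mxE mulf_neq0.
have LTpb : LTs lt (lform (p%:Z *: b)) = U_(j)%MM.
  apply: (LTs_uniq ltP) => // m'; rewrite lformZ mcoeffZ mulf_eq0 => /norP[_].
  by rewrite -mj; apply: lt_LTs.
have Ipb : in_ideal (gens S) (lform (p%:Z *: b)) by rewrite -eb; apply: in_ideal_lform.
have [|g gG /andP[]] := GS _ Ipb; first by apply: contraNneq pbj => ->; rewrite mcoeff0.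
have -> : LCs lt (lform (p%:Z *: b)) = p%:Z * b ord0 j.
  by rewrite /LCs LTpb mcoeff_lformU mxE.
rewrite LTpb => dvd_c dvd_t.
have Ig : in_ideal (gens S) g by apply/GE/in_ideal_gen.
(* No element of the ideal has a constant term, so [LT g] is not 1 and, dividing x_j, must be
   x_j. *)
have LTg : LTs lt g = U_(j)%MM := lem_mnm1 dvd_t (LTs_gens_neq0 Ig (G0 g gG)).
have [_ [eg geg]] := in_ideal_linpart Ig.
have gj : linpart g ord0 j = LCs lt g by rewrite mxE -LTg.
have /dvdzP[q bq] : (LCs lt g %| b ord0 j)%Z.
  rewrite -(Gauss_dvdzr _ (_ : coprimez _ p)) // coprimez_sym coprimezE.
  by rewrite prime_coprime //; apply/negP; apply: Gp gG.
(* Subtracting only the linear part of [g] keeps the remainder a linear form, and p times it stays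
   in the row lattice. *)
pose c := b - q *: linpart g.
suff [e' ce'] : exists e', c = e' *m forms_mx S.
  by exists (e' + q *: eg); rewrite mulmxDl -ce' -scalemxAl -geg subrK.
have cj : c ord0 j = 0 by rewrite !mxE bq -gj mxE subrr.
have [->|c0] := eqVneq c 0; first by exists 0; rewrite mul0mx.
have lc0 : lform c != 0 by rewrite lform_eq0.
apply: (IH (LTs lt (lform c)) _ c (e - (p%:Z * q) *: eg)) => //; last first.
  by rewrite mulmxBl eb -scalemxAl -geg -scalerA -scalerBr.
have [i -> ci] := mcoeff_lform_neq0 (LCs_neq0 ltP lc0).
have ij : U_(i)%MM != U_(j)%MM :> 'X_{1..l}.
  by rewrite eq_mnm1; apply: contraNneq ci => ->; rewrite cj.
(* The leading variable x_i of [c] occurs in [b] or else in [g]. Both have leading term x_j, and i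
   differs from j because the coefficients at j cancelled. *)
rewrite -LTb; have [bi|bi] := eqVneq (b ord0 i) 0.
  rewrite mj -LTg; apply: (lt_LTs ltP); last by rewrite LTg.
  by apply: contraNneq ci => gi; rewrite !mxE bi gi mulr0 subrr.
by apply: (lt_LTs ltP); rewrite ?mcoeff_lformU // mj.
Qed.

Lemma row_full_lucky S : row_full (forms_in 'F_p S) -> sigma_lucky lt (gens S) p.
Proof.
move=> /(int_left_inverse p_pr)[B [D pD BA]].
have [G GB] := min_strong_GB_exists ltP (gens S).
exists G; split=> // g gG pg; have [_ G0 GE _ _] := GB.
have Ig : in_ideal (gens S) g by apply/GE/in_ideal_gen.
have D0 : D != 0 by apply: contraNneq pD => ->; rewrite dvdz0.
(* [LT g] is not 1, so some x_j divides it, and D x_j is the form of row j of B A = D. *)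
have IDX : in_ideal (gens S) (D *: 'X_[LTs lt g]).
  have [j mj] : exists j, (U_(j) <= LTs lt g)%MM.
    have [j gj] := mnm_neq0 (LTs_gens_neq0 Ig (G0 g gG)).
    by exists j; rewrite lep1mP.
  rewrite -(submK mj) mpolyXD -mul_mpolyC mulrCA mul_mpolyC; apply: in_idealM.
  rewrite -lform_delta -lformZ.
  have -> : D *: delta_mx ord0 j = row j B *m forms_mx S.
    by rewrite -row_mul BA rowE mul_mx_scalar.
  exact: in_ideal_lform.
have LTD : LTs lt (D *: 'X_[LTs lt g]) = LTs lt g.
  apply: (LTs_uniq ltP) => [|m]; first by rewrite mcoeffZ mcoeffX eqxx mulr1.
  by rewrite mcoeffZ mcoeffX => + /negbTE ne; rewrite [_ == m]eq_sym ne mulr0 eqxx.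
have DX0 : D *: 'X_[LTs lt g] != 0 :> {mpoly int[l]}.
  by rewrite -msupp_eq0 msuppMCX.
have := min_strong_GB_LC_dvd ltP GB gG IDX DX0 LTD.
have -> : LCs lt (D *: 'X_[LTs lt g]) = D by rewrite /LCs LTD mcoeffZ mcoeffX eqxx mulr1.
by move/(dvdz_trans pg); apply/negP.
Qed.

End Arrangement.

(** * Comparing ranks over Q and over F_p *)

Section Ranks.

Variables (l n : nat) (alpha : 'I_n -> 'rV[int]_l).
Implicit Types S T : {set 'I_n}.

Local Notation rk F S := (\rank (fam_span (fun i => redF F (alpha i)) S)).

Lemma dimI_rank (F : fieldType) S : dimI F alpha S = (l - rk F S)%N.
Proof. by rewrite dimI_forms fam_span_forms. Qed.

Lemma redF_rat_eq0 (a : 'rV[int]_l) : (redF rat a == 0) = (a == 0).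
Proof.
apply/eqP/eqP => [/rowP a0|->]; apply/rowP => j; last by rewrite !mxE.
by have := a0 j; rewrite !mxE => /eqP; rewrite intr_eq0 => /eqP.
Qed.

Lemma hypS (F : fieldType) (a b : 'rV[int]_l) :
  (redF F a <= redF F b)%MS -> (hyp F b <= hyp F a)%MS.
Proof.
case/submxP => D ab; apply/sub_kermxP.
by rewrite ab trmx_mul mulmxA mulmx_ker mul0mx.
Qed.

(** In rank at most one, each of the two nonzero forms spans the whole span, hence each is a
    multiple of the other and the hyperplanes coincide. *)
Lemma fam_span_rank_pair i j : alpha i != 0 -> alpha j != 0 ->
  ~~ (hyp rat (alpha i) == hyp rat (alpha j))%MS -> (1 < rk rat [set i; j])%N.
Proof.
move=> ai aj; apply: contraR; rewrite -leqNgt => rk1.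
have sub k : k \in [set i; j] -> alpha k != 0 ->
    (fam_span (fun i => redF rat (alpha i)) [set i; j] <= redF rat (alpha k))%MS.
  move=> kS ak; have sk : (redF rat (alpha k) <=
      fam_span (fun i => redF rat (alpha i)) [set i; j])%MS.
    by apply: (sumsmx_sup k); rewrite ?genmxE.
  by rewrite -(geq_leqif (mxrank_leqif_sup sk)) rank_rV redF_rat_eq0 ak.
have sup k : k \in [set i; j] -> (redF rat (alpha k) <=
    fam_span (fun i => redF rat (alpha i)) [set i; j])%MS.
  by move=> kS; apply: (sumsmx_sup k); rewrite ?genmxE.
have iS : i \in [set i; j] by rewrite !inE eqxx.
have jS : j \in [set i; j] by rewrite !inE eqxx orbT.
by apply/andP; split; apply: hypS; [apply: submx_trans (sup j jS) (sub i _ _)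
  |apply: submx_trans (sup i iS) (sub j _ _)].
Qed.

Variable p : nat.
Hypothesis p_pr : prime p.

(** A maximal independent subfamily mod p stays independent over Q, by [row_free_Fp_rat]. *)
Lemma rank_Fp_le_rat S : (rk 'F_p S <= rk rat S)%N.
Proof.
have [B [_ sBS + ->]] :=
  indep_extend (sub0set S) (indep0 (fun i => redF 'F_p (alpha i))).
rewrite indepE => /(row_free_Fp_rat p_pr); rewrite -indepE => /eqP <-.
by rewrite mxrankS ?fam_spanS.
Qed.

Lemma comb_equiv_rank S : comb_equiv_mod alpha p -> S != set0 ->
  rk rat S = rk 'F_p S.
Proof.
move=> eqd /eqd; rewrite !dimI_rank => /(congr1 (subn l)).
by rewrite !subKn ?rank_leq_row.
Qed.

Lemma comb_equiv_good : central_essential_arrangement alpha ->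
  comb_equiv_mod alpha p -> good_prime alpha p.
Proof.
move=> [prim hyp_neq _] eqd i j lt_ij [c aij].
have S0 : [set i; j] != set0 by apply/set0Pn; exists i; rewrite !inE eqxx.
have ne_ij : i != j by rewrite -val_eqE neq_ltn lt_ij.
have [ai _] := prim i; have [aj _] := prim j.
have := fam_span_rank_pair ai aj (hyp_neq _ _ ne_ij).
rewrite (comb_equiv_rank eqd S0); apply/negP; rewrite -leqNgt.
apply: leq_trans (rank_leq_row (redF 'F_p (alpha j))).
apply/mxrankS/sumsmx_subP => k; rewrite !inE genmxE => /orP[]/eqP-> //.
by rewrite aij scalemx_sub.
Qed.

Variable lt : rel 'X_{1..l}.
Hypothesis ltP : term_order lt.

Lemma comb_equiv_lucky : comb_equiv_mod alpha p -> sigma_k_lucky lt alpha l p.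
Proof.
move=> eqd S cS; rewrite dimI_rank => rS; apply: row_full_lucky => //.
rewrite /row_full -fam_span_forms.
(* Combinatorial equivalence concerns nonempty [S]; an empty [S] has [l] = 0 elements, and full rank
   is then automatic. *)
have [S0|S0] := eqVneq S set0.
  have l0 : l = 0%N by rewrite -cS S0 cards0.
  by rewrite eqn_leq rank_leq_row {1}l0.
rewrite -comb_equiv_rank //; apply/eqP.
by have := rank_leq_row (fam_span (fun i => redF rat (alpha i)) S); lia.
Qed.

Lemma lucky_comb_equiv : dimI rat alpha setT = 0%N ->
  sigma_k_lucky lt alpha l p -> comb_equiv_mod alpha p.
Proof.
move=> ess lucky S _; rewrite !dimI_rank; congr (_ - _)%N; apply/eqP.
rewrite eqn_leq rank_Fp_le_rat andbT.
have [T [_ sTS iT ->]] :=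
  indep_extend (sub0set S) (indep0 (fun i => redF rat (alpha i))).
(* Luckiness speaks of subfamilies of size [l], so [T] is enlarged to such a family [B], available
   because the arrangement is essential; independence of [B] mod p then passes down to [T]. *)
have [B [sTB _ iB rT]] := indep_extend (subsetT T) iT.
have cB : #|B| = l.
  apply/eqP; rewrite -rT eqn_leq rank_leq_row /= -subn_eq0.
  by rewrite -(dimI_rank rat) ess.
have lB : sigma_lucky lt [seq lform (alpha i) | i <- enum B] p.
  by apply: lucky => //; rewrite dimI_rank (eqP iB) cB subnn subn0.
have ipB : indep (fun i => redF 'F_p (alpha i)) B.
  rewrite indepE; apply: saturated_row_free => // [|b e]; first by rewrite -indepE.
  exact: (lucky_saturated ltP p_pr lB).
have /eqP <- := indep_sub sTB ipB.
by rewrite mxrankS ?fam_spanS.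
Qed.

End Ranks.

Theorem theorem4p14 (l n : nat) (alpha : 'I_n -> 'rV[int]_l)
  (lt : rel 'X_{1..l}) (p : nat) :
  central_essential_arrangement alpha ->
  term_order lt ->
  prime p ->
  (good_prime alpha p /\ sigma_k_lucky lt alpha l p) <-> comb_equiv_mod alpha p.
Proof.
move=> arr ltP p_pr; split=> [[_ lucky]|eqd].
  by apply: lucky_comb_equiv lucky => //; case: arr.
by split; [apply: comb_equiv_good|apply: comb_equiv_lucky].
Qed.
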